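(* Let $w$ be a decreasing weight on $(0,\infty)$ and $w(\infty):=\lim_{t\to\infty}w(t)$. Then: (i) There exists a weight $v$ such that $\Lambda^1(w)=\Gamma^1(v)$ if and only if $w(\infty)=0$. (ii) $\Lambda^1(w)=L^1$ if and only if $w(\infty)>0$ and $w\in L^\infty$. (iii) There exists a weight $v$ such that $\Lambda^1(w)=\Gamma^1(v)\cap L^1$, $L^1\not\subset\Gamma^1(v)$ and $\Gamma^1(v)\not\subset L^1$ if and only if $w(\infty)>0$ and $w\notin L^\infty$.
   Context: A weight is a nonnegative locally integrable measurable function on $(0,\infty)$; ''decreasing'' means nonincreasing. For a measurable function $f$ on $\mathbb{R}^n$, $f^*$ is its decreasing rearrangement and $f^{**}(t)=\frac1t\int_0^t f^*(s)\,ds$. $\Lambda^1(w)$ is the set of $f$ with $\|f\|_{\Lambda^1(w)}=\int_0^\infty f^*(t)w(t)\,dt<\infty$; $\Gamma^1(v)$ is the set of $f$ with $\|f\|_{\Gamma^1(v)}=\int_0^\infty f^{**}(t)v(t)\,dt<\infty$; $L^1=L^1(\mathbb{R}^n)$; $\Gamma^1(v)\cap L^1$ carries the norm $\|f\|_{\Gamma^1(v)}+\|f\|_{L^1}$. $X\subset Y$ means there is $C$ with $\|f\|_Y\le C\|f\|_X$ for all $f$; $X=Y$ means both inclusions hold; $X\not\subset Y$ means $X\subset Y$ fails.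
   Formalization: Weights are required to be integrable on (0,t) for every t, not only on compact subsets of (0,∞); otherwise w(t)=1/t+1 gives Λ¹(w)={0} and refutes (i) and (iii). Only weights with Λ¹(w)={0} are excluded. *)

(* Defs.v *)
From HB Require Import structures.
From mathcomp Require Import all_boot all_order all_algebra.
From mathcomp Require Import all_classical all_reals all_analysis.
Set Implicit Arguments. Unset Strict Implicit. Unset Printing Implicit Defensive.
Import Order.TTheory GRing.Theory Num.Theory.
Import numFieldNormedType.Exports.
Local Open Scope classical_set_scope.
Local Open Scope ring_scope.

(** * Euclidean space R^n with Lebesgue measure

   [RpowS R k] is R^(k+1) realised as the iterated product
   R * (R * ( ... * R)) with the product sigma-algebra of the Borel
   sigma-algebras, and [lebS R k] is the (k+1)-dimensional Lebesgue
   measure on it, built as the iterated product measure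
   (mathcomp-analysis' [\x], i.e. A |-> \int[m1]_x m2 (xsection A x)). *)
Fixpoint RpowS (R : realType) (k : nat) : {d : measure_display & measurableType d} :=
  match k with
  | 0 => existT (fun d => measurableType d) _ (measurableTypeR R : measurableType _)
  | k'.+1 => existT (fun d => measurableType d) _
      ((measurableTypeR R * projT2 (@RpowS R k'))%type : measurableType _)
  end.

Fixpoint lebS (R : realType) (k : nat) : set (projT2 (RpowS R k)) -> \bar R :=
  match k return set (projT2 (RpowS R k)) -> \bar R with
  | 0 => @lebesgue_measure R
  | k'.+1 => ((@lebesgue_measure R) \x (@lebS R k'))%E
  end.

Section rearrangement_spaces.
Variable R : realType.

(** R^n (meaningful for n >= 1) and its Lebesgue measure. *)
Definition Rn (n : nat) := projT2 (RpowS R n.-1).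
Definition lebn (n : nat) : set (Rn n) -> \bar R := @lebS R n.-1.

Local Notation mu := (@lebesgue_measure R).

Definition weight (w : R -> R) : Prop :=
  [/\ measurable_fun `](0%R:R), +oo[ w,
      (forall t, 0 < t -> 0 <= w t) &
      (forall t, 0 < t -> mu.-integrable `](0%R:R), t[ (EFin \o w))].

Definition decreasing (w : R -> R) : Prop :=
  forall s t, 0 < s -> s <= t -> w t <= w s.

Definition w_infty (w : R -> R) : R := lim (w t @[t --> +oo]).

Definition Linfty (w : R -> R) : Prop :=
  exists M : R, {ae mu, forall t, `](0%R:R), +oo[%classic t -> `|w t| <= M}.

Variable n : nat.
Implicit Types f : Rn n -> R.

Definition distrib f (s : R) : \bar R := @lebn n [set x | s < `|f x|].

Definition rearr f (t : R) : \bar R :=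
  ereal_inf [set s%:E | s in [set s : R | 0 <= s /\ (distrib f s <= t%:E)%E]].

Definition rearr2 f (t : R) : \bar R :=
  ((t^-1)%:E * \int[mu]_(s in `](0%R:R), t[) rearr f s)%E.

Definition Lambda1_norm (w : R -> R) f : \bar R :=
  (\int[mu]_(t in `](0%R:R), +oo[) (rearr f t * (w t)%:E))%E.
Definition Gamma1_norm (v : R -> R) f : \bar R :=
  (\int[mu]_(t in `](0%R:R), +oo[) (rearr2 f t * (v t)%:E))%E.
Definition L1_norm f : \bar R := (\int[@lebn n]_x (`|f x|)%:E)%E.
Definition Gamma1_cap_L1_norm (v : R -> R) f : \bar R :=
  (Gamma1_norm v f + L1_norm f)%E.

Definition embeds (NX NY : (Rn n -> R) -> \bar R) : Prop :=
  exists C : R, 0 < C /\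
    forall f, measurable_fun setT f -> (NY f <= C%:E * NX f)%E.

Definition same_space (NX NY : (Rn n -> R) -> \bar R) : Prop :=
  embeds NX NY /\ embeds NY NX.

End rearrangement_spaces.

(* Main.v *)
Require Import Defs.
From HB Require Import structures.
From mathcomp Require Import all_boot all_order all_algebra.
From mathcomp Require Import all_classical all_reals all_analysis.
From mathcomp Require Import measurable_realfun measurable_fun_approximation lra ring.
Import Order.TTheory GRing.Theory Num.Theory.
Import numFieldNormedType.Exports.
Local Open Scope classical_set_scope.
Local Open Scope ring_scope.

(** All three norms have the form [f |-> \int f^* g] with [g] nonincreasing: [g = w] for
    Lambda^1(w), [g = 1] for L^1 (layer cake), and [g s = \int_s^oo v t / t dt], the tail
    of [v], for Gamma^1(v) (Tonelli). Testing on characteristic functions of sets of measure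
    [T] turns an embedding into [\int_0^T h <= C \int_0^T g] for all [T], and since [g] is
    nonincreasing, [c T <= C \int_0^T g] for all [T] forces [c <= C g]; this gives the
    necessary conditions, as the tail of [v] vanishes at infinity. Conversely, if
    [w(oo) = 0], then [v t = w (t / 2) - w t] has a tail between [w s / 2] and [w (s / 2)],
    and [\int f^* t w (t / 2) dt <= 2 \int f^* w] by scaling. When [w(oo) > 0], apply this
    to [w - w(oo)]; the constant [w(oo)] contributes the L^1 norm. *)

(** * Nonincreasing functions and Tonelli's theorem *)

Section decreasing_functions.
Context {R : realType}.
Local Open Scope ereal_scope.
Local Notation mu := (@lebesgue_measure R).
Implicit Types (g : R -> \bar R) (a T : R).

(** By monotonicity the preimage in [A] of a ray unbounded above is order-convex, hence an interval,
    and such rays generate the sigma-algebra of the extended reals. *)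
Lemma nonincreasing_emeasurable (A : set R) g : is_interval A ->
  (forall s t, A s -> A t -> (s <= t)%R -> g t <= g s) -> measurable_fun A g.
Proof.
move=> iA gA; have mA : measurable A by exact: is_interval_measurable.
apply: (measurability (@ErealGenCInfty.G R)).
  exact: ErealGenCInfty.measurableE.
move=> _ [_ [r ->] <-]; apply: is_interval_measurable.
move=> s t [As /= gs] [At gt] u /andP[su ut].
have Au : A u by apply: (iA s t) => //; rewrite su ut.
split=> //=; move: gt; rewrite !in_itv/= !andbT => gt.
exact: (le_trans gt (gA _ _ Au At ut)).
Qed.

(** Values are extended reals so that [rearr f] and [tail v], which may be infinite, are covered;
    only the behaviour on the open half-line is constrained. *)
Definition nonneg_decreasing g :=
  (forall t : R, (0 < t)%R -> 0 <= g t) /\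
  (forall s t : R, (0 < s)%R -> (s <= t)%R -> g t <= g s).

Lemma nonneg_decreasing_measurable {g} (B : set R) : nonneg_decreasing g ->
  measurable B -> B `<=` `](0%R:R), +oo[ -> measurable_fun B g.
Proof.
move=> [_ gd] mB BD; apply: (measurable_funS _ BD) => //.
apply: nonincreasing_emeasurable; first exact: interval_is_interval.
by move=> s t /=; rewrite in_itv/= andbT => s0 _; exact: gd.
Qed.

Lemma itv0_sub T : `](0%R:R), T[ `<=` `](0%R:R), +oo[.
Proof. by move=> x /=; rewrite !in_itv/= => /andP[->]. Qed.

Lemma mule_le_integral g T : nonneg_decreasing g -> (0 < T)%R ->
  T%:E * g T <= \int[mu]_(t in `](0%R:R), T[) g t.
Proof.
move=> gd T0; have [g0 gD] := gd.
have -> : T%:E * g T = \int[mu]_(t in `](0%R:R), T[) g T.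
  rewrite integral_cst//= lebesgue_measure_itv/= lte_fin T0 sube0.
  by rewrite muleC.
apply: ge0_le_integral => //.
- by move=> t _; exact: g0 T0.
- exact: (nonneg_decreasing_measurable _ gd _ (@itv0_sub T)).
- by move=> t /=; rewrite in_itv/= => /andP[t0 /ltW]; exact: gD.
Qed.

(** Beyond [a] the integrand is at most [g a]. The length [T - a] is relaxed to [T], which costs
    nothing when [T] is large. *)
Lemma integral_le_head_mule g a T : nonneg_decreasing g -> (0 < a)%R -> (a <= T)%R ->
  \int[mu]_(t in `](0%R:R), T[) g t <=
  \int[mu]_(t in `](0%R:R), a[) g t + T%:E * g a.
Proof.
move=> gd a0 aT; have [g0 gD] := gd.
have T0 := lt_le_trans a0 aT.
have sub : `[a, T[ `<=` `](0%R:R), T[.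
  by move=> x /=; rewrite !in_itv/= => /andP[ax ->]; rewrite (lt_le_trans a0).
have -> : `](0%R:R), T[%classic = `](0%R:R), a[ `|` `[a, T[.
  by rewrite -itv_bndbnd_setU// bnd_simp.
rewrite ge0_integral_setU//=; first last.
- rewrite disj_set2E; apply/eqP/seteqP; split => // x [] /=.
  by rewrite !in_itv/= => /andP[_ xa] /andP[]; rewrite leNgt xa.
- by move=> x [|/sub] /=; rewrite in_itv/= => /andP[x0 _]; exact: g0.
- apply: (nonneg_decreasing_measurable _ gd); first exact: measurableU.
  by move=> x [/itv0_sub|/sub/itv0_sub].
rewrite leeD2l//; apply: (@le_trans _ _ (\int[mu]_(t in `[a, T[) g a)).
  apply: ge0_le_integral => //.
  - by move=> t /sub /=; rewrite in_itv/= => /andP[t0 _]; exact: g0.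
  - by apply: (nonneg_decreasing_measurable _ gd) => // x /sub /itv0_sub.
  - by move=> t /=; rewrite in_itv/= => /andP[+ _]; exact: gD.
rewrite integral_cst//= lebesgue_measure_itv/= lte_fin.
case: ifPn => _; last by rewrite mule0 mule_ge0// ?g0// lee_fin ltW.
rewrite muleC -EFinD lee_wpmul2r ?g0// lee_fin; lra.
Qed.

(** Splitting the integral at [a] gives [c T <= C (K + T g(a))] for [T >= a], with [K] the finite
    integral up to [a]; after division by [T] the term [K] disappears as [T] grows. *)
Lemma le_value_of_le_mean g (c C : R) : nonneg_decreasing g ->
  (forall T, (0 < T)%R -> \int[mu]_(t in `](0%R:R), T[) g t < +oo) ->
  (0 <= C)%R ->
  (forall T, (0 < T)%R ->
    (c * T)%:E <= C%:E * \int[mu]_(t in `](0%R:R), T[) g t) ->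
  forall a, (0 < a)%R -> c%:E <= C%:E * g a.
Proof.
move=> gd gfin C0 cC a a0; have [g0 gD] := gd.
have ga_fin : g a \is a fin_num.
  rewrite ge0_fin_numE ?g0//.
  have := le_lt_trans (mule_le_integral _ _ gd a0) (gfin _ a0).
  have := g0 _ a0; case: (g a) => [r _ _|_|//]; first by rewrite ltry.
  by rewrite gt0_muley// lte_fin.
have I0 : 0 <= \int[mu]_(t in `](0%R:R), a[) g t.
  by apply: integral_ge0 => t /=; rewrite in_itv/= => /andP[/g0].
have If : \int[mu]_(t in `](0%R:R), a[) g t \is a fin_num.
  by rewrite ge0_fin_numE// gfin.
have key T : (a <= T)%R ->
    (c * T <= C * (fine (\int[mu]_(t in `](0%R:R), a[) g t) + T * fine (g a)))%R.
  move=> aT; rewrite -lee_fin; apply: (le_trans (cC _ (lt_le_trans a0 aT))).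
  rewrite EFinM EFinD EFinM !fineK// lee_wpmul2l ?lee_fin//.
  exact: integral_le_head_mule.
rewrite -(fineK ga_fin) -EFinM lee_fin leNgt; apply/negP => lt_c.
set K := fine (\int[mu]_(t in `](0%R:R), a[) g t) in key.
have K0 : (0 <= K)%R by rewrite fine_ge0.
pose d := (c - C * fine (g a))%R; have d0 : (0 < d)%R by rewrite /d subr_gt0.
(* If [d > 0], this [T] satisfies [d T = d a + C K + 1 > C K], contradicting [key]. *)
pose T := (a + (C * K + 1) / d)%R.
have CK : (0 <= C * K)%R by rewrite mulr_ge0.
have aT : (a <= T)%R by rewrite /T lerDl divr_ge0// ?ltW//; lra.
have := key T aT; rewrite leNgt => /negP; apply.
rewrite -subr_gt0.
have -> : (c * T - C * (K + T * fine (g a)) = d * T - C * K)%R by rewrite /d; ring.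
rewrite /T mulrDr [(d * (_ / d))%R]mulrC divfK ?gt_eqF//.
have := mulr_gt0 d0 a0; lra.
Qed.

End decreasing_functions.

Section tonelli.
Local Open Scope ereal_scope.
Context d1 d2 (T1 : measurableType d1) (T2 : measurableType d2) (R : realType).
Variable m1 : {sigma_finite_measure set T1 -> \bar R}.
Variable m2 : {sigma_finite_measure set T2 -> \bar R}.

(** Extending [f] by zero outside the rectangle reduces this to Tonelli's theorem on the whole
    product. *)
Lemma fubini_tonelli_on (A : set T1) (B : set T2) (f : T1 * T2 -> \bar R) :
  measurable A -> measurable B -> measurable_fun (A `*` B) f ->
  (forall x y, A x -> B y -> 0 <= f (x, y)) ->
  \int[m1]_(x in A) \int[m2]_(y in B) f (x, y) =
  \int[m2]_(y in B) \int[m1]_(x in A) f (x, y).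
Proof.
move=> mA mB mf f0; pose g := f \_ (A `*` B).
have mg : measurable_fun setT g.
  by apply/(measurable_restrictT f) => //; exact: measurableX.
have g0 z : 0 <= g z.
  by apply: erestrict_ge0 => -[x y] [Ax By]; exact: f0.
have gE x y : g (x, y) = if (x \in A) && (y \in B) then f (x, y) else 0.
  by rewrite /g patchE in_setX.
rewrite [LHS]integral_mkcond [RHS]integral_mkcond.
transitivity (\int[m1]_x \int[m2]_y g (x, y)).
  apply: eq_integral => x _; rewrite patchE; case: ifPn => xA.
    by rewrite integral_mkcond; apply: eq_integral => y _; rewrite gE xA patchE.
  by rewrite integral0_eq// => y _; rewrite gE (negbTE xA).
rewrite fubini_tonelli//; apply: eq_integral => y _; rewrite patchE; case: ifPn => yB.
  by rewrite [RHS]integral_mkcond; apply: eq_integral => x _; rewrite gE yB andbT patchE.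
by rewrite integral0_eq// => x _; rewrite gE (negbTE yB) andbF.
Qed.

End tonelli.

(** * Scaling and tails *)

Section scaling.
Context {R : realType}.
Local Open Scope ereal_scope.
Local Notation mu := (@lebesgue_measure R).

(** Uniqueness of Lebesgue measure: [c] times the pushforward gives every interval []a, b]] its
    length. *)
Lemma lebesgue_measure_preimageZ (c : R) (A : set (measurableTypeR R)) : (0 < c)%R ->
  measurable A ->
  pushforward mu ( *%R c : _ -> measurableTypeR R) A = c^-1%:E * mu A.
Proof.
move=> c0 mA.
have mc : measurable_fun setT ( *%R c : measurableTypeR R -> measurableTypeR R).
  exact: measurable_funM.
have -> : mu A = pushforward (mscale (NngNum (ltW c0)) mu)
    ( *%R c : _ -> measurableTypeR R) A.
  apply: lebesgue_measure_unique => //= _ [[a b]] _ <-.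
  rewrite /pushforward /mscale/=.
  have -> : ( *%R c) @^-1` `]a, b] = `](a / c)%R, (b / c)%R]%classic.
    apply/seteqP; split => x /=; rewrite !in_itv/= ltr_pdivrMr// ler_pdivlMr//;
    by rewrite [(x * c)%R]mulrC.
  rewrite !lebesgue_measure_itv/= !lte_fin ltr_pM2r ?invr_gt0//.
  case: ifPn => _; last by rewrite mule0.
  by rewrite -!EFinB -EFinM -mulrBl mulrC divfK// gt_eqF.
by rewrite /pushforward /mscale/= muleA -EFinM mulVf ?gt_eqF// mul1e.
Qed.

Lemma ge0_integral_scale (c : R) (A B : set R) (f : R -> \bar R) : (0 < c)%R ->
  measurable A -> measurable_fun A f -> (forall x, A x -> 0 <= f x) ->
  B = ( *%R c) @^-1` A ->
  \int[mu]_(x in B) f (c * x)%R = c^-1%:E * \int[mu]_(x in A) f x.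
Proof.
move=> c0 mA mf f0 ->.
have mc : measurable_fun setT ( *%R c : measurableTypeR R -> measurableTypeR R).
  exact: measurable_funM.
have c0' : (0 <= c^-1)%R by rewrite invr_ge0 ltW.
transitivity (\int[pushforward mu ( *%R c : _ -> measurableTypeR R)]_(x in A) f x).
  by rewrite ge0_integral_pushforward// => y /set_mem; exact: f0.
transitivity (\int[mscale (NngNum c0') mu]_(x in A) f x).
  by apply: eq_measure_integral => S mS _; rewrite /mscale/=; exact: lebesgue_measure_preimageZ.
by rewrite ge0_integral_mscale.
Qed.

End scaling.

Section tails.
Context {R : realType}.
Local Open Scope ereal_scope.
Local Notation mu := (@lebesgue_measure R).
Implicit Types (h : R -> \bar R) (s : R).

Lemma itvoy_sub s : (0 < s)%R -> `]s, +oo[ `<=` `](0%R:R), +oo[.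
Proof. by move=> s0 x /=; rewrite !in_itv/= !andbT; exact: lt_trans. Qed.

Lemma ge0_integral_itv_split h (a b : R) (c : itv_bound R) :
  (a <= b)%R -> (BRight b <= c)%O ->
  measurable_fun [set` Interval (BRight a) c] h -> (forall t, (a < t)%R -> 0 <= h t) ->
  \int[mu]_(t in [set` Interval (BRight a) c]) h t =
  \int[mu]_(t in `]a, b]) h t + \int[mu]_(t in [set` Interval (BRight b) c]) h t.
Proof.
move=> ab bc mh h0.
have E : [set` Interval (BRight a) c] = `]a, b] `|` [set` Interval (BRight b) c].
  by rewrite -itv_bndbnd_setU.
rewrite E ge0_integral_setU//.
- by rewrite -E.
- rewrite -E => x /=; rewrite itv_boundlr => /andP[+ _].
  by rewrite bnd_simp; exact: h0.
- rewrite disj_set2E; apply/eqP/seteqP; split => // x [] /=.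
  rewrite !itv_boundlr !bnd_simp => /andP[_ xb] /andP[bx _].
  by move: bx; rewrite ltNge xb.
Qed.

Lemma cvg_integral_itvoy h s : measurable_fun `]s, +oo[ h ->
  (forall t, (s < t)%R -> 0 <= h t) ->
  \int[mu]_(t in `]s, (s + n%:R)%R]) h t @[n --> \oo] --> \int[mu]_(t in `]s, +oo[) h t.
Proof.
move=> mh h0.
rewrite [X in _ --> \int[mu]_(_ in X) _](itv_bndy_bigcup_BRight false s).
have sub n : `]s, (s + n%:R)%R] `<=` `]s, +oo[.
  by move=> x /=; rewrite !in_itv/= => /andP[->].
apply: (@ge0_nondecreasing_set_cvg_integral _ (measurableTypeR R) R
  (fun n : nat => `]s, (s + n%:R)%R]%classic) h mu).
- apply/nondecreasing_seqP => n; rewrite subsetEset => x /=.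
  rewrite !in_itv/= => /andP[-> /le_trans]; apply.
  by rewrite lerD2l ler_nat.
- by move=> n; exact: measurable_itv.
- by move=> n; apply: measurable_funS mh.
- by move=> n x /=; rewrite in_itv/= => /andP[sx _]; exact: h0.
Qed.

Lemma integral_itvoy_le h s (B : \bar R) : measurable_fun `]s, +oo[ h ->
  (forall t, (s < t)%R -> 0 <= h t) ->
  (forall T, (s <= T)%R -> \int[mu]_(t in `]s, T]) h t <= B) ->
  \int[mu]_(t in `]s, +oo[) h t <= B.
Proof.
move=> mh h0 hB; have cv := @cvg_integral_itvoy h s mh h0.
rewrite -(cvg_lim _ cv)//; apply: lime_le.
  by apply/cvg_ex; eexists; exact: cv.
by apply: nearW => n; apply: hB; rewrite lerDl.
Qed.

Definition tail (v : R -> R) s : \bar R := \int[mu]_(t in `]s, +oo[) (v t / t)%:E.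

Lemma weight_div (v : R -> R) : weight v ->
  measurable_fun `](0%R:R), +oo[ (fun t => (v t / t)%:E) /\
  (forall t : R, (0 < t)%R -> 0 <= (v t / t)%:E).
Proof.
move=> [mv v0 _]; split; last first.
  by move=> t t0; rewrite lee_fin divr_ge0// ?v0// ltW.
apply/measurable_EFinP; apply: measurable_funM => //.
apply: open_continuous_measurable_fun; first exact: interval_open.
by move=> x; rewrite inE/= in_itv/= andbT => x0; apply: inv_continuous; rewrite gt_eqF.
Qed.

Lemma tail_nonneg_decreasing (v : R -> R) : weight v -> nonneg_decreasing (tail v).
Proof.
move=> /weight_div[mv v0']; split=> [t t0|s t s0 st].
  apply: integral_ge0 => x /=; rewrite in_itv/= andbT => tx.
  by apply: v0'; exact: lt_trans tx.
apply: ge0_subset_integral => //.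
- by apply: measurable_funS mv => //; exact: itvoy_sub.
- by move=> x /=; rewrite in_itv/= andbT => /(lt_trans s0); exact: v0'.
- by move=> x /=; rewrite !in_itv/= !andbT; exact: le_lt_trans.
Qed.

(** The remainder of a convergent integral tends to zero; finiteness at one point [a] provides the
    convergence and allows the subtraction. *)
Lemma tail_small (v : R -> R) (a : R) : weight v -> (0 < a)%R -> tail v a < +oo ->
  forall e : R, (0 < e)%R -> exists2 b : R, (0 < b)%R & tail v b < e%:E.
Proof.
move=> wv a0 fin_a e e0; have [tv0 _] := tail_nonneg_decreasing _ wv.
have [mv v0'] := weight_div _ wv.
have mva : measurable_fun `]a, +oo[ (fun t => (v t / t)%:E).
  by apply: measurable_funS mv => //; exact: itvoy_sub.
have fa : tail v a \is a fin_num by rewrite ge0_fin_numE// tv0.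
have h0 t : (a < t)%R -> 0 <= (v t / t)%:E by move=> /(lt_trans a0); exact: v0'.
have := @cvg_integral_itvoy _ _ mva h0.
rewrite -/(tail v a) => cv.
have lt_e : tail v a - e%:E < tail v a by rewrite lteBlDr// lteDl// lte_fin.
have : nbhs (tail v a) [set y | tail v a - e%:E < y].
  by apply: open_nbhs_nbhs; split => //; exact: open_ereal_gt_ereal.
move=> /cv/= [N _ /(_ N (leqnn N))/= HN].
exists (a + N%:R)%R; first by rewrite ltr_wpDr.
have E : tail v a =
    \int[mu]_(t in `]a, (a + N%:R)%R]) (v t / t)%:E + tail v (a + N%:R)%R.
  by apply: ge0_integral_itv_split => //; rewrite lerDl.
have fN : tail v (a + N%:R)%R \is a fin_num.
  rewrite ge0_fin_numE ?tv0 ?ltr_wpDr//; apply: le_lt_trans fin_a.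
  by rewrite E leeDr// integral_ge0// => x /=; rewrite in_itv/= => /andP[/h0].
move: fN HN fa; rewrite E.
move: (tail v _) (\int[mu]_(t in _) _) => [x| |] [y| |]//= _.
by rewrite -!EFinD !lte_fin => + _; lra.
Qed.

End tails.

(** * Dyadic difference of a decreasing weight and estimates of its tail *)

Section dyadic_difference.
Context {R : realType}.
Local Open Scope ereal_scope.
Local Notation mu := (@lebesgue_measure R).
Variable w : R -> R.
Hypotheses (ww : weight w) (dw : decreasing w).

Let w0 t : (0 < t)%R -> (0 <= w t)%R. Proof. by have [_ + _] := ww; exact. Qed.

Lemma weight_nonneg_decreasing : nonneg_decreasing (EFin \o w).
Proof.
by split=> [t t0|s t s0 st] /=; rewrite lee_fin; [exact: w0|exact: dw].
Qed.

Lemma integral_weight_lty (T : R) : (0 < T)%R -> \int[mu]_(t in `](0%R:R), T[) (w t)%:E < +oo.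
Proof.
move=> T0; have [_ _ /(_ _ T0) /integrableP[_]] := ww.
congr (_ < _); apply: eq_integral => t; rewrite inE/= in_itv/= => /andP[t0 _].
by rewrite ger0_norm// w0.
Qed.

(* Chosen so that the integral of [v t / t] over [(s, oo)] telescopes to that of
   [w t / t] over [(s / 2, s)] when [w] vanishes at infinity. *)
Definition dyadic_difference (t : R) : R := (w (t / 2) - w t)%R.

Let half_gt0 (t : R) : (0 < t)%R -> (0 < t / 2)%R.
Proof. by move=> t0; rewrite divr_gt0. Qed.

Lemma integral_weight_half (T : R) : (0 < T)%R ->
  \int[mu]_(t in `](0%R:R), T[) (w (t / 2))%:E =
  2%:E * \int[mu]_(t in `](0%R:R), (T / 2)%R[) (w t)%:E.
Proof.
move=> T0; under eq_integral do rewrite mulrC.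
have := @ge0_integral_scale R (2^-1) `](0%R:R), (T / 2)%R[ `](0%R:R), T[ (EFin \o w).
rewrite invrK; apply => //=.
- apply: nonneg_decreasing_measurable => //; last exact: itv0_sub.
- by move=> x; rewrite in_itv/= => /andP[/w0 + _]; rewrite lee_fin.
- apply/seteqP; split => x /=; rewrite !in_itv/= pmulr_rgt0// mulrC ltr_pM2r//.
Qed.

Lemma measurable_weight_half : measurable_fun `](0%R:R), +oo[ (fun t => w (t / 2)).
Proof.
apply/measurable_EFinP; apply: nonincreasing_emeasurable => [|s t/=].
  exact: interval_is_interval.
rewrite in_itv/= andbT lee_fin => s0 _ st; apply: dw; first exact: half_gt0.
by rewrite ler_pM2r.
Qed.

(** Nonnegativity is the monotonicity of [w]. Local integrability follows from domination by
    [w (t / 2)], whose integral up to [T] is twice that of [w] up to [T / 2]. *)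
Lemma weight_dyadic_difference : weight dyadic_difference.
Proof.
have v0 t : (0 < t)%R -> (0 <= dyadic_difference t)%R.
  move=> t0; rewrite subr_ge0 dw ?half_gt0// ler_pdivrMr//; lra.
have mv : measurable_fun `](0%R:R), +oo[ dyadic_difference.
  by apply: measurable_funB; [exact: measurable_weight_half|have [] := ww].
split => // T T0; apply/integrableP; split.
  apply/measurable_EFinP; apply: measurable_funS mv => //; exact: itv0_sub.
apply: (@le_lt_trans _ _ (\int[mu]_(t in `](0%R:R), T[) (w (t / 2))%:E)).
  apply: ge0_le_integral => //=.
  - apply/measurable_EFinP; apply: measurableT_comp => //.
    apply: measurable_funS mv => //; exact: itv0_sub.
  - apply/measurable_EFinP; apply: measurable_funS measurable_weight_half => //.
    exact: itv0_sub.
  - move=> t; rewrite in_itv/= => /andP[t0 _]; rewrite lee_fin ger0_norm ?v0//.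
    by rewrite /dyadic_difference gerBl w0.
by rewrite integral_weight_half// lte_mul_pinfty// ?lee_fin// integral_weight_lty// half_gt0.
Qed.

(** The integral of [w t / t] may diverge both at 0 and at infinity, so the telescoping is carried
    out on bounded intervals away from 0, where [Q] is finite. *)
Let Q (a b : R) := \int[mu]_(t in `]a, b]) (w t / t)%:E.

Let itvoc_sub (a b : R) : (0 < a)%R -> `]a, b] `<=` `](0%R:R), +oo[.
Proof.
by move=> a0 x /=; rewrite !in_itv/= andbT => /andP[+ _]; exact: lt_trans.
Qed.

(** Both [w] and [1 / t] are nonincreasing, so [w t / t] lies between its values at the endpoints.
    For [b = 2 a] the bounds become [w b / 2] and [w a]. *)
Let Q_bounds (a b : R) : (0 < a)%R -> (a <= b)%R ->
  ((b - a) * (w b / b))%:E <= Q a b <= ((b - a) * (w a / a))%:E.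
Proof.
move=> a0 ab; have b0 := lt_le_trans a0 ab; have [mw w0'] := weight_div _ ww.
have ba (c : R) : ((b - a) * c)%:E = \int[mu]_(t in `]a, b]) c%:E.
  rewrite integral_cst//= lebesgue_measure_itv/= lte_fin.
  case: ltgtP ab => [ab _|//|-> _]; first by rewrite muleC -EFinB -EFinM.
  by rewrite subrr mul0r mule0.
rewrite !ba; apply/andP; split; apply: ge0_le_integral => //=.
- by move=> t _; exact: w0'.
- by apply: measurable_funS mw => //; exact: itvoc_sub.
- move=> t; rewrite in_itv/= => /andP[ta tb]; have t0 := lt_trans a0 ta.
  by rewrite lee_fin ler_pM ?w0 ?invr_ge0 ?lef_pV2 ?posrE ?(ltW b0) ?(ltW t0) ?dw.
- by move=> t; rewrite in_itv/= => /andP[ta tb]; apply/w0'/lt_trans/ta.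
- by apply: measurable_funS mw => //; exact: itvoc_sub.
- move=> t; rewrite in_itv/= => /andP[ta tb]; have t0 := lt_trans a0 ta.
  by rewrite lee_fin ler_pM ?w0 ?invr_ge0 ?lef_pV2 ?posrE ?(ltW a0) ?(ltW t0) ?dw ?(ltW ta).
Qed.

Let Q_fin (a b : R) : (0 < a)%R -> (a <= b)%R -> Q a b \is a fin_num.
Proof.
move=> a0 /(Q_bounds _ _ a0)/andP[l u]; rewrite fin_numElt.
by rewrite (lt_le_trans _ l) ?ltNyr// (le_lt_trans u) ?ltry.
Qed.

Let Q_split (a b c : R) : (0 < a)%R -> (a <= b)%R -> (b <= c)%R -> Q a c = Q a b + Q b c.
Proof.
move=> a0 ab bc; have [mw w0'] := weight_div _ ww.
apply: ge0_integral_itv_split => //.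
- by apply: measurable_funS mw => //; exact: itvoc_sub.
- by move=> t ta; apply: w0'; exact: lt_trans ta.
Qed.

(** The measure [dt / t] is invariant under dilations. *)
Let Q_half (a b : R) : (0 < a)%R -> (a <= b)%R ->
  \int[mu]_(t in `]a, b]) (w (t / 2) / t)%:E = Q (a / 2) (b / 2).
Proof.
move=> a0 ab; have a20 := half_gt0 _ a0; have [mw w0'] := weight_div _ ww.
have Q0 : 0 <= Q (a / 2) (b / 2).
  by apply: integral_ge0 => t /(itvoc_sub _ _ a20)/=; rewrite in_itv/= andbT; exact: w0'.
have mwQ : measurable_fun `](a / 2)%R, (b / 2)%R] (fun t => (w t / t)%:E).
  by apply: measurable_funS mw => //; exact: itvoc_sub.
have w0Q t : `](a / 2)%R, (b / 2)%R]%classic t -> 0 <= (w t / t)%:E.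
  by move=> /(itvoc_sub _ _ a20)/=; rewrite in_itv/= andbT; exact: w0'.
pose f t := 2^-1%:E * (w t / t)%:E.
transitivity (\int[mu]_(t in `]a, b]) f (2^-1 * t)%R).
  apply: eq_integral => t; rewrite inE => /(itvoc_sub _ _ a0)/=.
  rewrite in_itv/= andbT => t0; rewrite /f -EFinM [(2^-1 * t)%R]mulrC; congr EFin.
  by field; rewrite gt_eqF.
rewrite (@ge0_integral_scale R (2^-1) `](a / 2)%R, (b / 2)%R])//.
- rewrite /f ge0_integralZl ?lee_fin ?invr_ge0//.
  by rewrite invrK muleA -EFinM divff// mul1e.
- exact: measurable_funeM.
- by move=> t /w0Q t0; rewrite mule_ge0// lee_fin invr_ge0.
- by apply/seteqP; split => x /=; rewrite !in_itv/= [(2^-1 * x)%R]mulrC ltr_pM2r// ler_pM2r.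
Qed.

(** By dilation invariance the first integral plus [Q s T] is [Q (s / 2) (T / 2)]. Splitting
    [Q (s / 2) T] once at [s] and once at [T / 2] and cancelling the finite [Q s T] gives the
    identity, whatever the order of [s] and [T / 2]. *)
Let telescope (s T : R) : (0 < s)%R -> (s <= T)%R ->
  \int[mu]_(t in `]s, T]) (dyadic_difference t / t)%:E + Q (T / 2) T = Q (s / 2) s.
Proof.
move=> s0 sT; have T0 := lt_le_trans s0 sT.
have [mw w0'] := weight_div _ ww; have [mv v0] := weight_div _ weight_dyadic_difference.
have le_half (t : R) : (0 < t)%R -> (t / 2 <= t)%R by move=> t0; rewrite ler_pdivrMr//; lra.
have sum : \int[mu]_(t in `]s, T]) (dyadic_difference t / t)%:E + Q s T = Q (s / 2) (T / 2).
  rewrite -Q_half// -ge0_integralD//=.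
  - by apply: eq_integral => t _; rewrite -EFinD -mulrDl subrK.
  - by move=> t; rewrite in_itv/= => /andP[st _]; apply/v0/lt_trans/st.
  - by apply: measurable_funS mv => //; exact: itvoc_sub.
  - by move=> t; rewrite in_itv/= => /andP[st _]; apply/w0'/lt_trans/st.
  - by apply: measurable_funS mw => //; exact: itvoc_sub.
have := Q_split _ _ _ (half_gt0 _ s0) (le_half _ s0) sT.
rewrite (Q_split (s / 2) (T / 2) T) ?half_gt0 ?le_half ?ler_pM2r// -sum => E.
have := Q_fin _ _ s0 sT; have := Q_fin _ _ (half_gt0 _ s0) (le_half _ s0).
have := Q_fin _ _ (half_gt0 _ T0) (le_half _ T0); move: E.
move: (Q _ _) (Q _ _) (Q _ _) (\int[mu]_(t in _) _) => [x| |] [y| |] [z| |] [u| |]//=.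
by rewrite -!EFinD => -[E] _ _ _; congr EFin; lra.
Qed.

(** Dropping the nonnegative boundary term [Q (T / 2) T] from [telescope] leaves the bound
    [Q (s / 2) s <= w (s / 2)], uniform in [T]. *)
Lemma tail_dyadic_difference_le (s : R) : (0 < s)%R -> tail dyadic_difference s <= (w (s / 2))%:E.
Proof.
move=> s0; have [mv v0] := weight_div _ weight_dyadic_difference.
apply: integral_itvoy_le => [|t st|T sT].
- by apply: measurable_funS mv => //; exact: itvoy_sub.
- by apply: v0; exact: lt_trans st.
- have T0 := lt_le_trans s0 sT.
  have T2 : (T / 2 <= T)%R by rewrite ler_pdivrMr//; lra.
  have s2 : (s / 2 <= s)%R by rewrite ler_pdivrMr//; lra.
  have /andP[QT _] := Q_bounds _ _ (half_gt0 _ T0) T2.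
  have /andP[_ Qs] := Q_bounds _ _ (half_gt0 _ s0) s2.
  apply: (@le_trans _ _ (Q (s / 2) s)).
    rewrite -(telescope _ _ s0 sT) leeDl//; apply: le_trans QT.
    by rewrite lee_fin mulr_ge0 ?divr_ge0 ?w0 ?subr_ge0// ltW.
  apply: (le_trans Qs); rewrite lee_fin le_eqVlt; apply/orP; left; apply/eqP.
  by field; rewrite gt_eqF.
Qed.

(** Here the boundary term matters: [Q (T / 2) T <= w (T / 2)] becomes arbitrarily small for large
    [T], while [Q (s / 2) s >= w s / 2]. *)
Lemma tail_dyadic_difference_ge (s : R) :
  (forall e : R, (0 < e)%R -> exists2 a : R, (0 < a)%R & (w a < e)%R) ->
  (0 < s)%R -> (w s / 2)%:E <= tail dyadic_difference s.
Proof.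
move=> small s0; have [mv v0] := weight_div _ weight_dyadic_difference.
apply/lee_addgt0Pr => /= e e0; have [a a0 wa] := small _ e0.
(* Large enough for [telescope] to apply and for [w (T / 2) <= w a < e]. *)
pose T : R := Num.max s (a * 2)%R.
have sT : (s <= T)%R by rewrite le_max lexx.
have aT : (a <= T / 2)%R by rewrite ler_pdivlMr// le_max lexx orbT.
have T0 := lt_le_trans s0 sT.
have T2 : (T / 2 <= T)%R by rewrite ler_pdivrMr//; lra.
have s2 : (s / 2 <= s)%R by rewrite ler_pdivrMr//; lra.
have /andP[_ QT] := Q_bounds _ _ (half_gt0 _ T0) T2.
have /andP[Qs _] := Q_bounds _ _ (half_gt0 _ s0) s2.
apply: (@le_trans _ _ (Q (s / 2) s)).
  apply: le_trans Qs; rewrite lee_fin le_eqVlt; apply/orP; left; apply/eqP.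
  by field; rewrite gt_eqF.
rewrite -(telescope _ _ s0 sT); apply: leeD.
  apply: ge0_subset_integral => //=.
  - by apply: measurable_funS mv => //; exact: itvoy_sub.
  - by move=> t; rewrite in_itv/= andbT => st; apply/v0/lt_trans/st.
  - by move=> t /=; rewrite !in_itv/= => /andP[->].
apply: (le_trans QT); rewrite lee_fin; apply: (@le_trans _ _ (w (T / 2))).
  rewrite le_eqVlt; apply/orP; left; apply/eqP; by field; rewrite gt_eqF.
by apply: ltW; apply: le_lt_trans wa; exact: dw.
Qed.

End dyadic_difference.

(** * The norms as weighted integrals of the rearrangement *)

Section layer_cake.
Context {R : realType}.
Local Open Scope ereal_scope.
Local Notation mu := (@lebesgue_measure R).

(** Such an [A] is the interval from 0 to [y] with the endpoint [y] left undecided, so strict and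
    weak sublevel conditions are treated alike. *)
Lemma lebesgue_measure_between (y : \bar R) (A : set R) : measurable A -> 0 <= y ->
  A `<=` `](0%R:R), +oo[ ->
  (forall s : R, (0 < s)%R -> s%:E < y -> A s) -> (forall s : R, A s -> s%:E <= y) ->
  mu A = y.
Proof.
move=> + y0; case: y y0 => [r| |//] y0 mA AD Al Au.
  have r0 : (0 <= r)%R by [].
  have mr (b : bool) : mu [set` Interval (BRight (0%R:R)) (BSide b r)] = r%:E.
    rewrite lebesgue_measure_itv/= lte_fin sube0.
    by case: ltgtP r0 => // <-.
  apply/eqP; rewrite eq_le; apply/andP; split.
    rewrite -[leRHS](mr false); apply: le_measure; rewrite ?inE// => s As.
    by have := AD _ As; have := Au _ As; rewrite /= !in_itv/= lee_fin => -> /andP[->].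
  rewrite -[leLHS](mr true); apply: le_measure; rewrite ?inE// => s /=.
  by rewrite in_itv/= => /andP[s0 sr]; apply: Al; rewrite ?lte_fin.
have -> : A = `](0%R:R), +oo[%classic.
  apply/seteqP; split => // s /=; rewrite in_itv/= andbT => s0.
  by apply: Al; rewrite ?ltry.
by rewrite lebesgue_measure_itv/= ltry sube0.
Qed.

(** Tonelli for the indicator of [K], which stands for the region below the graph of [y]: each
    section of [K] over [x] has measure [y x]. Boundary points are left free so that [K] can be
    described by whichever inequality is at hand. *)
Lemma layer_cake d (X : measurableType d) (m : {sigma_finite_measure set X -> \bar R})
    (A : set X) (y : X -> \bar R) (K : set (X * measurableTypeR R)) :
  measurable A -> measurable K -> (forall x, A x -> 0 <= y x) ->
  (forall x (s : R), A x -> (0 < s)%R -> s%:E < y x -> K (x, s)) ->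
  (forall x (s : R), A x -> (0 < s)%R -> K (x, s) -> s%:E <= y x) ->
  \int[m]_(x in A) y x =
  \int[mu]_(s in `](0%R:R), +oo[) m ([set x | K (x, s)] `&` A).
Proof.
move=> mA mK y0 Kl Ku.
have mKx x : measurable [set s : measurableTypeR R | K (x, s)].
  by have := measurable_xsection x mK; rewrite /xsection; under eq_set do rewrite in_setE.
have mKy (s : measurableTypeR R) : measurable [set x | K (x, s)].
  by have := measurable_ysection s mK; rewrite /ysection; under eq_set do rewrite in_setE.
transitivity (\int[m]_(x in A) \int[mu]_(s in `](0%R:R), +oo[) (\1_K (x, s))%:E).
  apply: eq_integral => x; rewrite inE => Ax.
  transitivity (\int[mu]_(s in `](0%R:R), +oo[) (\1_[set s | K (x, s)] s)%:E) => //.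
  rewrite integral_indic//; symmetry; apply: lebesgue_measure_between.
  - by apply: measurableI => //; exact: (mKx x).
  - exact: y0.
  - by move=> s [].
  - by move=> s s0 sy; split; [exact: Kl|rewrite /= in_itv/= s0].
  - by move=> s [Ks]; rewrite /= in_itv/= andbT => s0; exact: Ku.
rewrite (fubini_tonelli_on _ _ _ _ _ m mu _ _ (fun z => (\1_K z)%:E))//; last first.
- by apply: measurable_funTS; apply/measurable_EFinP.
apply: eq_integral => s _.
transitivity (\int[m]_(x in A) (\1_[set x | K (x, s)] x)%:E) => //.
by rewrite integral_indic.
Qed.

End layer_cake.

(** * Sigma-finiteness of the iterated product measure and sets of prescribed measure *)

Section product_sigma_finite.
Local Open Scope ereal_scope.
Context d1 d2 (T1 : measurableType d1) (T2 : measurableType d2) (R : realType).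
Variable m1 : {sigma_finite_measure set T1 -> \bar R}.
Variable m2 : {sigma_finite_measure set T2 -> \bar R}.

(** The exhaustions are taken increasing, so that a single index, the maximum of two, serves both
    factors. *)
Lemma sigma_finite_product : sigma_finite setT (m1 \x m2).
Proof.
have /sigma_finiteP[F [TF ndF Foo]] := sigma_finiteT m1.
have /sigma_finiteP[G [TG ndG Goo]] := sigma_finiteT m2.
exists (fun n => F n `*` G n) => [|k].
  apply/esym; rewrite -subTset => -[x y] _.
  have [i _ Fix] : (\bigcup_i F i) x by rewrite -TF.
  have [j _ Gjy] : (\bigcup_i G i) y by rewrite -TG.
  exists (maxn i j) => //; split => /=.
    by move: Fix; exact/subsetPset/ndF/leq_maxl.
  by move: Gjy; exact/subsetPset/ndG/leq_maxr.
have [mF Fk] := Foo k; have [mG Gk] := Goo k; split; first exact: measurableX.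
by rewrite product_measure1E// lte_mul_pinfty// ge0_fin_numE.
Qed.

(* Canonical inference on [m1 \x m2] only finds the sigma-finite structure of a
   product of subprobabilities. *)
Definition product_sigma_finite_measure : {sigma_finite_measure set (T1 * T2)%type -> \bar R} :=
  HB.pack (m1 \x m2) (@Measure_isSigmaFinite.Build _ _ _ (m1 \x m2) sigma_finite_product).

End product_sigma_finite.

Section lebesgue_Rn.
Context {R : realType}.
Local Open Scope ereal_scope.

(** [lebn] is defined by recursion as a bare set function; induction on the dimension recovers the
    measure structure that integration and Tonelli rely on. *)
Lemma lebn_measure (n : nat) :
  exists m : {sigma_finite_measure set (Rn R n) -> \bar R}, @lebn R n = m.
Proof.
rewrite /Rn /lebn; elim: n.-1 => [|k [m E]]; first by exists (@lebesgue_measure R).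
by exists (product_sigma_finite_measure _ _ _ _ _ (@lebesgue_measure R) m); rewrite /= E.
Qed.

(** Take []0, T]] in the first coordinate times a set of measure 1 in the remaining ones. *)
Lemma lebn_set (n : nat) (T : R) : (0 <= T)%R ->
  exists2 E : set (Rn R n), measurable E & @lebn R n E = T%:E.
Proof.
rewrite /Rn /lebn.
have box (S : R) : (0 <= S)%R -> @lebesgue_measure R `](0%R:R), S] = S%:E.
  by move=> S0; rewrite lebesgue_measure_itv/= lte_fin sube0; case: ltgtP S0 => // <-.
elim: n.-1 T => [|k IH] T T0; first by exists `](0%R:R), T]%classic;
  [exact: measurable_itv|exact: box].
have [E mE E1] := IH _ (@ler01 R).
have [m Em] := lebn_measure k.+1.
exists (`](0%R:R), T]%classic `*` E : set (measurableTypeR R * projT2 (RpowS R k))%type).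
  exact: measurableX.
rewrite /lebn /Rn /= in m Em; rewrite /= Em product_measure1E//.
by rewrite [X in X * _](box _ T0) -Em E1 mule1.
Qed.

End lebesgue_Rn.

(** * Distribution functions, rearrangements and the common form of the three norms *)

Section rearrangement.
Context {R : realType} {n : nat}.
Local Open Scope ereal_scope.
Local Notation mu := (@lebesgue_measure R).
Implicit Types (f : Rn R n -> R) (s t : R) (g : R -> \bar R).

Lemma measurable_gt_norm f s : measurable_fun setT f -> measurable [set x | (s < `|f x|)%R].
Proof.
move=> mf; rewrite -[X in measurable X]setTI.
rewrite [X in measurable (_ `&` X)](_ : _ = [set x | s%:E < (`|f x|)%:E]).
  by apply: measurable_lte => //; apply/measurable_EFinP; exact: measurableT_comp.
by apply/seteqP; split => x; rewrite /= lte_fin.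
Qed.

Lemma distrib_nonincreasing f s t : measurable_fun setT f -> (s <= t)%R ->
  distrib f t <= distrib f s.
Proof.
move=> mf st; rewrite /distrib; have [m ->] := @lebn_measure R n.
apply: le_measure; rewrite ?inE; [exact: measurable_gt_norm..|].
by move=> x /=; exact: le_lt_trans.
Qed.

Lemma distrib_ge0 f s : 0 <= distrib f s.
Proof. by rewrite /distrib; have [m ->] := @lebn_measure R n. Qed.

Lemma rearr_ge0 f t : 0 <= rearr f t.
Proof. by apply: le_ereal_inf_tmp => _ [s [s0 _] <-]; rewrite lee_fin. Qed.

Lemma rearr_nonneg_decreasing f : nonneg_decreasing (rearr f).
Proof.
split=> [t _|s t _ st]; first exact: rearr_ge0.
apply: ereal_inf_le_tmp => _ [r [r0 fr] <-]; exists r => //; split => //.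
by apply: le_trans fr _; rewrite lee_fin.
Qed.

(** Together with [lt_distrib], this says that the regions below the graphs of [rearr f] and
    [distrib f] are mirror images up to boundary points. That suffices for [layer_cake] and avoids
    right-continuity of the distribution function. *)
Lemma lt_rearr f s t : (0 <= s)%R -> s%:E < rearr f t -> t%:E < distrib f s.
Proof.
move=> s0; rewrite !ltNge; apply: contra => fs.
by apply: ge_ereal_inf; exists s%:E => //; exists s.
Qed.

Lemma lt_distrib f s t : measurable_fun setT f -> t%:E < distrib f s -> s%:E <= rearr f t.
Proof.
move=> mf ts; apply: le_ereal_inf_tmp => _ [r [r0 fr] <-]; rewrite lee_fin leNgt.
apply/negP => /ltW rs; have := le_lt_trans (le_trans (distrib_nonincreasing _ _ _ mf rs) fr) ts.
by rewrite ltxx.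
Qed.

Lemma measurable_distrib f : measurable_fun setT f -> measurable_fun setT (distrib f : R -> \bar R).
Proof.
move=> mf; apply: nonincreasing_emeasurable => // s t _ _.
exact: distrib_nonincreasing.
Qed.

Definition Lambda g f := \int[mu]_(t in `](0%R:R), +oo[) (rearr f t * g t).

(** In [layer_cake], [K] is the region below the graph of [distrib f], whose slice at height [s] is
    the interval from 0 to [distrib f s]. *)
Lemma integral_rearr f : measurable_fun setT f ->
  \int[mu]_(t in `](0%R:R), +oo[) rearr f t = \int[mu]_(s in `](0%R:R), +oo[) distrib f s.
Proof.
move=> mf; pose K := [set z : measurableTypeR R * measurableTypeR R | z.1%:E < distrib f z.2].
have mK : measurable K.
  rewrite -[K]setTI; apply: measurable_lte => //.
    exact/measurable_EFinP.
  by apply: (measurableT_comp (measurable_distrib _ mf)).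
rewrite (@layer_cake R _ _ mu _ _ K)//.
- apply: eq_integral => s _; apply: lebesgue_measure_between.
  + by apply: measurableI => //; have := measurable_ysection s mK;
      rewrite /ysection; under eq_set do rewrite in_setE.
  + exact: distrib_ge0.
  + by move=> t [].
  + by move=> t t0 ts; split => //=; rewrite in_itv/= t0.
  + by move=> t [/ltW].
- by move=> t _; exact: rearr_ge0.
- by move=> t s _ /ltW; exact: lt_rearr.
- by move=> t s _ _; exact: lt_distrib.
Qed.

(** Both sides equal the integral of the distribution function: the right one by [integral_rearr],
    the left one by the layer cake formula on the Euclidean space. *)
Lemma L1_normE f : measurable_fun setT f -> L1_norm f = Lambda (cst 1) f.
Proof.
move=> mf; rewrite /Lambda; under eq_integral do rewrite mule1.
rewrite integral_rearr// /L1_norm /distrib; have [m ->] := @lebn_measure R n.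
pose K := [set z : Rn R n * measurableTypeR R | (z.2%:E < (`|f z.1|)%:E)].
rewrite (@layer_cake R _ _ m _ _ K)//.
- apply: eq_integral => s _; rewrite setIT; congr (m _).
- rewrite -[K]setTI; apply: measurable_lte => //; first exact/measurable_EFinP.
  apply/measurable_EFinP; apply: measurableT_comp => //.
  exact: measurableT_comp.
- by move=> x s _ _ /ltW.
Qed.

Lemma Gamma1_normE (v : R -> R) f : weight v -> Gamma1_norm v f = Lambda (tail v) f.
Proof.
move=> wv; have [mv v0] := weight_div _ wv.
have mr := nonneg_decreasing_measurable _ (rearr_nonneg_decreasing f).
have mrD : measurable_fun `](0%R:R), +oo[ (rearr f) by exact: mr.
pose K := [set z : measurableTypeR R * measurableTypeR R | (z.2 < z.1)%R].
have KE t s : \1_K (t, s) = (s < t)%R%:R :> R.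
  by rewrite indicE; congr ((nat_of_bool _)%:R); apply/idP/idP => [/set_mem//|st]; exact/mem_set.
have mK : measurable K.
  rewrite -[K]setTI (_ : K = [set z | z.2%:E < z.1%:E]); last first.
    by apply/seteqP; split => z; rewrite /K/= lte_fin.
  by apply: measurable_lte => //; exact/measurable_EFinP.
(* The indicator of the triangle [s < t] turns the variable limits of [rearr2] and of [tail] into
   integrals over a fixed quadrant, where the order can be exchanged. *)
pose F (z : measurableTypeR R * measurableTypeR R) :=
  (v z.1 / z.1)%:E * (rearr f z.2 * (\1_K z)%:E).
have mF : measurable_fun (`](0%R:R), +oo[ `*` `](0%R:R), +oo[) F.
  have mD : measurable (`](0%R:R), +oo[ `*` `](0%R:R), +oo[ :
      set (measurableTypeR R * measurableTypeR R)).
    exact: measurableX.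
  apply: emeasurable_funM; last apply: emeasurable_funM.
  - apply: (measurable_comp _ _ mv) => //; last exact: measurable_funTS.
    by move=> _ [z [z1 _] <-].
  - apply: (measurable_comp _ _ mrD) => //; last exact: measurable_funTS.
    by move=> _ [z [_ z2] <-].
  - by apply: measurable_funTS; apply/measurable_EFinP.
transitivity (\int[mu]_(t in `](0%R:R), +oo[) \int[mu]_(s in `](0%R:R), +oo[) F (t, s)).
  apply: eq_integral => t; rewrite inE/= in_itv/= andbT => t0.
  have -> : rearr2 f t * (v t)%:E = (v t / t)%:E * \int[mu]_(s in `](0%R:R), t[) rearr f s.
    by rewrite /rearr2 muleAC -EFinM [(_ * v t)%R]mulrC.
  rewrite -ge0_integralZl//; last 3 first.
  - by apply: mr => //; exact: itv0_sub.
  - by move=> s _; exact: rearr_ge0.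
  - exact: v0.
  rewrite integral_mkcond [RHS]integral_mkcond; apply: eq_integral => s _.
  rewrite !patchE /F KE !mem_setE !in_itv/= andbT.
  by case: (0 < s)%R => //=; case: ltP => st; rewrite ?mulr1n ?mulr0n ?mule1 ?mule0.
rewrite (fubini_tonelli_on _ _ _ _ _ mu mu _ _ F)//; last first.
  move=> t s /=; rewrite in_itv/= andbT => t0 _.
  by rewrite mule_ge0 ?v0// mule_ge0 ?rearr_ge0// lee_fin.
apply: eq_integral => s; rewrite inE/= in_itv/= andbT => s0.
rewrite /tail -ge0_integralZl//; last 3 first.
- by apply: measurable_funS mv => //; exact: itvoy_sub.
- by move=> t /=; rewrite in_itv/= andbT => /(lt_trans s0); exact: v0.
- exact: rearr_ge0.
rewrite [LHS]integral_mkcond [RHS]integral_mkcond; apply: eq_integral => t _.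
rewrite !patchE /F KE !mem_setE !in_itv/= !andbT.
case: (ltP s t) => st; first by rewrite (lt_trans s0 st) mulr1n mule1 muleC.
by case: ifP => // _; rewrite mulr0n !mule0.
Qed.

End rearrangement.

(** * Test functions and comparison *)

Section weighted_rearrangement.
Context {R : realType} {n : nat}.
Local Open Scope ereal_scope.
Local Notation mu := (@lebesgue_measure R).
Implicit Types (f : Rn R n -> R) (g h : R -> \bar R).

Let measurable_rearrM f g : nonneg_decreasing g ->
  measurable_fun `](0%R:R), +oo[ (fun t => rearr f t * g t).
Proof.
move=> gd; apply: emeasurable_funM.
  by apply: nonneg_decreasing_measurable => //; exact: rearr_nonneg_decreasing.
exact: nonneg_decreasing_measurable.
Qed.

Let rearrM_ge0 f g (t : R) : nonneg_decreasing g ->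
  (`](0%R:R), +oo[%classic : set R) t -> 0 <= rearr f t * g t.
Proof.
by move=> [g0 _] /=; rewrite in_itv/= andbT => t0; rewrite mule_ge0 ?rearr_ge0 ?g0.
Qed.

Lemma Lambda_ge0 f g : nonneg_decreasing g -> 0 <= Lambda g f.
Proof. by move=> gd; apply: integral_ge0 => t; exact: rearrM_ge0. Qed.

Lemma le_Lambda f g h : nonneg_decreasing g -> nonneg_decreasing h ->
  (forall t : R, (0 < t)%R -> g t <= h t) -> Lambda g f <= Lambda h f.
Proof.
move=> gd hd gh; apply: ge0_le_integral => //.
- by move=> t; exact: rearrM_ge0.
- exact: measurable_rearrM.
- exact: measurable_rearrM.
- move=> t /=; rewrite in_itv/= andbT => t0.
  by rewrite lee_wpmul2l ?rearr_ge0 ?gh.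
Qed.

Lemma LambdaD f g h : nonneg_decreasing g -> nonneg_decreasing h ->
  Lambda (fun t => g t + h t) f = Lambda g f + Lambda h f.
Proof.
move=> gd hd; rewrite /Lambda -ge0_integralD//; last 4 first.
- by move=> t; exact: rearrM_ge0.
- exact: measurable_rearrM.
- by move=> t; exact: rearrM_ge0.
- exact: measurable_rearrM.
apply: eq_integral => t; rewrite inE/= in_itv/= andbT => t0.
by rewrite ge0_muleDr//; [have [g0 _] := gd; exact: g0|have [h0 _] := hd; exact: h0].
Qed.

Lemma LambdaZ f g (c : R) : nonneg_decreasing g -> (0 <= c)%R ->
  Lambda (fun t => c%:E * g t) f = c%:E * Lambda g f.
Proof.
move=> gd c0; rewrite /Lambda -ge0_integralZl//; last 2 first.
- exact: measurable_rearrM.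
- by move=> t; exact: rearrM_ge0.
by apply: eq_integral => t _; rewrite muleCA.
Qed.

Lemma nonneg_decreasingZ g (c : R) : (0 <= c)%R -> nonneg_decreasing g ->
  nonneg_decreasing (fun t => c%:E * g t).
Proof.
move=> c0 [g0 gd]; split=> [t t0|s t s0 st]; first by rewrite mule_ge0 ?lee_fin ?g0.
by rewrite lee_wpmul2l ?lee_fin ?gd.
Qed.

Lemma nonneg_decreasing_cst (c : R) : (0 <= c)%R ->
  nonneg_decreasing (cst c%:E : R -> \bar R).
Proof. by split. Qed.

(* Substituting [t = 2 u] trades [w (t / 2)] for [rearr f (2 u) <= rearr f u]. *)
Lemma Lambda_half f (w : R -> R) : weight w -> decreasing w ->
  Lambda (fun t => (w (t / 2))%:E) f <= 2%:E * Lambda (EFin \o w) f.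
Proof.
move=> ww dw; have wd := weight_nonneg_decreasing _ ww dw.
have [rf0 rfd] := rearr_nonneg_decreasing f.
pose F (u : R) := rearr f (2 * u)%R * (w u)%:E.
have mF : measurable_fun `](0%R:R), +oo[ F.
  apply: emeasurable_funM; last exact: (nonneg_decreasing_measurable _ wd).
  apply: nonincreasing_emeasurable => [|s t /=]; first exact: interval_is_interval.
  by rewrite in_itv/= andbT => s0 _ st; apply: rfd; rewrite ?mulr_gt0 ?ler_pM2l.
have F0 (t : R) : (`](0%R:R), +oo[%classic : set R) t -> 0 <= F t.
  rewrite /= in_itv/= andbT => t0; rewrite mule_ge0 ?rearr_ge0//.
  by have [w0 _] := wd; exact: w0.
have -> : Lambda (fun t => (w (t / 2))%:E) f =
    \int[mu]_(t in `](0%R:R), +oo[) F (2^-1 * t)%R.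
  by apply: eq_integral => t _; rewrite /F mulrA divff// mul1r [(_ * t)%R]mulrC.
rewrite (@ge0_integral_scale R (2^-1) `](0%R:R), +oo[)//; last first.
  by apply/seteqP; split => x /=; rewrite !in_itv/= !andbT pmulr_rgt0.
rewrite invrK lee_wpmul2l ?lee_fin//; apply: ge0_le_integral => //.
  exact: measurable_rearrM.
move=> t /=; rewrite in_itv/= andbT => t0.
rewrite lee_wpmul2r//; first by have [w0 _] := wd; exact: w0.
by apply: rfd => //; rewrite ler_peMl ?(ltW t0)// ler1n.
Qed.

(** The distribution function of the indicator is [T] on [[0, 1[] and 0 at 1, so the infimum
    defining [rearr] is 1 when [t < T] and 0 otherwise. *)
Lemma rearr_indic (E : set (Rn R n)) (T t : R) : (0 < T)%R -> lebn E = T%:E ->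
  (0 < t)%R -> rearr \1_E t = (t < T)%R%:R%:E.
Proof.
move=> T0 ET t0.
have dE s : (0 <= s)%R -> (s < 1)%R -> distrib \1_E s = T%:E.
  move=> s0 s1; rewrite /distrib -ET; congr (lebn _); apply/seteqP; split => x /=.
    rewrite indicE; case: (boolP (x \in E)) => [/set_mem//|_].
    by rewrite normr0 ltNge s0.
  by move=> Ex; rewrite indicE mem_set// normr1.
have d1 : distrib \1_E 1%R = 0.
  rewrite /distrib; have [m ->] := @lebn_measure R n.
  rewrite (_ : [set x | _] = set0) ?measure0//; apply/seteqP; split => x //=.
  by rewrite indicE; case: (x \in E); rewrite ?normr1 ?normr0 ?ltxx// ltNge ler01.
case: ltP => tT; apply/eqP; rewrite eq_le; apply/andP; split.
- by apply: ge_ereal_inf; exists 1 => //; exists 1%R => //; split => //; rewrite d1 lee_fin ltW.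
- apply: le_ereal_inf_tmp => _ [s [s0 st] <-]; rewrite lee_fin leNgt; apply/negP => s1.
  by move: st; rewrite dE// lee_fin leNgt tT.
- by apply: ge_ereal_inf; exists 0 => //; exists 0%R => //; split => //; rewrite dE ?lee_fin.
- exact: rearr_ge0.
Qed.

Lemma Lambda_indic g (E : set (Rn R n)) (T : R) : (0 < T)%R -> lebn E = T%:E ->
  Lambda g \1_E = \int[mu]_(t in `](0%R:R), T[) g t.
Proof.
move=> T0 ET; rewrite /Lambda [LHS]integral_mkcond [RHS]integral_mkcond.
apply: eq_integral => t _; rewrite !patchE !mem_setE !in_itv/= andbT.
case: ltP => //= t0; rewrite (rearr_indic _ _ _ T0 ET t0).
by case: ltP => _; rewrite ?mulr1n ?mulr0n ?mul1e ?mul0e.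
Qed.

Lemma embeds_integral_le (NX NY : (Rn R n -> R) -> \bar R) g h :
  (forall f, measurable_fun setT f -> NX f = Lambda g f) ->
  (forall f, measurable_fun setT f -> NY f = Lambda h f) -> embeds NX NY ->
  exists2 C : R, (0 < C)%R & forall T : R, (0 < T)%R ->
    \int[mu]_(t in `](0%R:R), T[) h t <= C%:E * \int[mu]_(t in `](0%R:R), T[) g t.
Proof.
move=> XE YE [C [C0 XY]]; exists C => // T T0.
have [E mE ET] := lebn_set n _ (ltW T0).
have mf : measurable_fun setT (\1_E : Rn R n -> R) by exact: measurable_indic.
by have := XY _ mf; rewrite XE// YE// !(Lambda_indic _ _ _ T0 ET).
Qed.

Lemma integral_cst_itv0 (c T : R) : (0 < T)%R ->
  \int[mu]_(t in `](0%R:R), T[) (cst c%:E) t = (c * T)%:E.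
Proof.
by move=> T0; rewrite integral_cst//= lebesgue_measure_itv/= lte_fin T0 sube0.
Qed.

End weighted_rearrangement.

(** * The limit of a decreasing weight at infinity *)

Section limit_at_infinity.
Context {R : realType}.
Variable w : R -> R.
Hypotheses (ww : weight w) (dw : decreasing w).

Let w0 t : 0 < t -> 0 <= w t. Proof. by have [_ + _] := ww; exact. Qed.

Lemma w_infty_spec :
  [/\ 0 <= w_infty w, forall t, 0 < t -> w_infty w <= w t &
      forall e, 0 < e -> exists2 a : R, 0 < a & w a < w_infty w + e].
Proof.
pose A := w @` `](0:R), +oo[.
have infA : has_inf A.
  split; first by exists (w 1), 1 => //=; rewrite in_itv/= ltr01.
  by exists 0 => _ [t /= + <-]; rewrite in_itv/= andbT; exact: w0.
have le_w t : 0 < t -> inf A <= w t.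
  move=> t0; apply: ge_inf; first by case: infA.
  by exists t => //=; rewrite in_itv/= t0.
have near_w e : 0 < e -> exists2 a : R, 0 < a & w a < inf A + e.
  move=> e0; have [_ [a /= + <-] wa] := inf_adherent e0 infA.
  by rewrite in_itv/= andbT => a0; exists a.
(* [lim] carries information only once convergence is proved; monotonicity gives convergence to the
   infimum, whose properties are the three claims. *)
have -> : w_infty w = inf A.
  apply: cvg_lim => //; apply/cvgrPdist_lt => e e0.
  have [a a0 wa] := near_w _ e0.
  near=> t.
  have at_ : a <= t by near: t; apply: nbhs_pinfty_ge; exact: num_real.
  have := le_w _ (lt_le_trans a0 at_); have := dw _ _ a0 at_.
  by move=> ? ?; rewrite ltr_norml; apply/andP; split; lra.
split => //; apply: lb_le_inf; first by case: infA.
by move=> _ [t /= + <-]; rewrite in_itv/= andbT; exact: w0.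
Unshelve. all: by end_near. Qed.

End limit_at_infinity.

(** * Embeddings *)

Section embeddings.
Context {R : realType} {n : nat}.
Local Open Scope ereal_scope.
Local Notation mu := (@lebesgue_measure R).
Local Notation L1 := (@L1_norm R n).
Local Notation Lam := (@Lambda1_norm R n).
Local Notation Gam := (@Gamma1_norm R n).

Lemma embeds_trans (NX NY NZ : (Rn R n -> R) -> \bar R) :
  embeds NX NY -> embeds NY NZ -> embeds NX NZ.
Proof.
move=> [C [C0 XY]] [D [D0 YZ]]; exists (D * C)%R; split; first exact: mulr_gt0.
move=> f mf; apply: (le_trans (YZ _ mf)).
by rewrite EFinM -muleA lee_wpmul2l ?lee_fin ?(ltW D0)// XY.
Qed.

Lemma L1_norm_ge0 f : 0 <= L1 f.
Proof.
rewrite /L1_norm; have [m ->] := @lebn_measure R n.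
by apply: integral_ge0 => x _; rewrite lee_fin.
Qed.

Lemma Gamma1_norm_ge0 (v : R -> R) f : weight v -> 0 <= Gam v f.
Proof.
by move=> wv; rewrite Gamma1_normE//; apply: Lambda_ge0; exact: tail_nonneg_decreasing.
Qed.

Lemma embeds_cap_L1 (v : R -> R) : weight v -> embeds (@Gamma1_cap_L1_norm R n v) L1.
Proof.
by move=> wv; exists 1%R; split => // f mf; rewrite mul1e leeDr// Gamma1_norm_ge0.
Qed.

Lemma embeds_cap_Gamma1 (v : R -> R) : embeds (@Gamma1_cap_L1_norm R n v) (Gam v).
Proof. by exists 1%R; split => // f mf; rewrite mul1e leeDl// L1_norm_ge0. Qed.

Section decreasing_weight.
Variable w : R -> R.
Hypotheses (ww : weight w) (dw : decreasing w).

Let w0 (t : R) : (0 < t)%R -> (0 <= w t)%R. Proof. by have [_ + _] := ww; exact. Qed.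
Let wd := weight_nonneg_decreasing _ ww dw.

(** If a decreasing [w] exceeds [M] at [t], it exceeds [M] on all of []0, t[], a set of positive
    measure; hence an essential bound is a pointwise one. *)
Lemma Linfty_le : Linfty w <-> exists M : R, forall t : R, (0 < t)%R -> (w t <= M)%R.
Proof.
split=> [[M [N [mN N0 sub]]]|[M wM]]; exists M.
  move=> t t0; rewrite leNgt; apply/negP => Mw.
  have : mu `](0%R:R), t[ <= mu N.
    apply: le_measure; rewrite ?inE// => s /=; rewrite in_itv/= => /andP[s0 st].
    apply: sub => /=; apply/not_implyP; split; first by rewrite in_itv/= s0.
    apply/negP; rewrite -ltNge (lt_le_trans Mw)// (le_trans (dw _ _ s0 (ltW st)))//.
    exact: ler_norm.
  by rewrite N0 lebesgue_measure_itv/= lte_fin t0 sube0 lee_fin leNgt t0.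
apply: aeW => t; rewrite /= in_itv/= andbT => t0.
by rewrite ger0_norm ?w0 ?wM.
Qed.

Lemma embeds_L1_Lambda1 : Linfty w -> embeds L1 (Lam w).
Proof.
move=> /Linfty_le[M wM]; have M0 : (0 <= M)%R by exact: le_trans (w0 _ ltr01) (wM _ ltr01).
(* The added 1 keeps the constant positive when [M = 0]. *)
exists (M + 1)%R; split => [|f mf]; first by rewrite ltr_pwDr.
rewrite L1_normE// -LambdaZ ?addr_ge0//.
apply: le_Lambda => //.
  by apply: nonneg_decreasingZ; [rewrite addr_ge0|exact: nonneg_decreasing_cst].
move=> t t0; rewrite mule1 lee_fin; apply: (le_trans (wM _ t0)).
by rewrite lerDl.
Qed.

(** Testing bounds the integral of [w] over []0, t[] by [C t], and that integral is at least
    [t * w t]. *)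
Lemma embeds_L1_Lambda1_Linfty : embeds L1 (Lam w) -> Linfty w.
Proof.
move=> /(embeds_integral_le _ _ (cst 1) (EFin \o w) L1_normE (fun _ _ => erefl))[C C0 CW].
apply/Linfty_le; exists C => t t0; have := CW _ t0.
rewrite integral_cst_itv0// => /(le_trans (mule_le_integral _ _ wd t0)).
by rewrite -!EFinM lee_fin mul1r [(C * t)%R]mulrC ler_pM2l.
Qed.

(** Testing bounds the means of [w] over []0, T[] from below by [C^-1]; [le_value_of_le_mean] turns
    this into a pointwise bound. *)
Lemma embeds_Lambda1_L1_ge : embeds (Lam w) L1 ->
  exists2 c : R, (0 < c)%R & forall t : R, (0 < t)%R -> (c <= w t)%R.
Proof.
move=> /(embeds_integral_le _ _ (EFin \o w) (cst 1) (fun _ _ => erefl) L1_normE)[C C0 CW].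
exists (C^-1)%R => [|t t0]; first by rewrite invr_gt0.
have : 1 <= C%:E * (EFin \o w) t.
  apply: le_value_of_le_mean t0 => //; [exact: integral_weight_lty|exact: ltW|].
  by move=> T T0; have := CW _ T0; rewrite integral_cst_itv0.
by rewrite -EFinM lee_fin -ler_pdivrMl// mulr1.
Qed.

Lemma embeds_Lambda1_L1 : embeds (Lam w) L1 <-> (0 < w_infty w)%R.
Proof.
have [wi0 wi_le wi_near] := w_infty_spec _ ww dw.
split=> [/embeds_Lambda1_L1_ge[c c0 cw]|wi].
  rewrite ltNge; apply/negP => wi; have [a a0] := wi_near _ c0.
  by have := cw _ a0; lra.
exists ((w_infty w)^-1)%R; split => [|f mf]; first by rewrite invr_gt0.
rewrite L1_normE// -LambdaZ ?invr_ge0//; apply: le_Lambda.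
- exact: nonneg_decreasing_cst.
- by apply: nonneg_decreasingZ => //; rewrite invr_ge0.
- by move=> t t0; rewrite /= -EFinM lee_fin ler_pdivlMl// mulr1 wi_le.
Qed.

Lemma same_space_dyadic_difference : w_infty w = 0%R ->
  same_space (Lam w) (Gam (dyadic_difference w)).
Proof.
move=> wi0; have [_ _ wi_near] := w_infty_spec _ ww dw.
have small (e : R) : (0 < e)%R -> exists2 a : R, (0 < a)%R & (w a < e)%R.
  by move=> /wi_near; rewrite wi0 add0r.
have wv := weight_dyadic_difference _ ww dw; have td := tail_nonneg_decreasing _ wv.
split; exists 2%R; split => // f mf; rewrite Gamma1_normE//.
  apply: le_trans (Lambda_half f _ ww dw); apply: le_Lambda => //.
  - split=> [t t0|s t s0 st]; rewrite lee_fin ?w0 ?divr_gt0//.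
    by apply: dw; rewrite ?divr_gt0// ler_pM2r.
  - by move=> t; exact: tail_dyadic_difference_le.
rewrite -LambdaZ//; apply: le_Lambda => //; first exact: nonneg_decreasingZ.
move=> t t0; apply: (@le_trans _ _ (2%:E * (w t / 2)%:E)).
  by rewrite -EFinM lee_fin mulrC divfK.
by rewrite lee_wpmul2l ?lee_fin//; exact: tail_dyadic_difference_ge.
Qed.

(** The inclusion of Lambda in Gamma makes the tail of [v] finite, so it tends to 0 at infinity. The
    reverse inclusion bounds [w_infty w] by a constant times every value of that tail. *)
Lemma same_space_Gamma1_w_infty (v : R -> R) : weight v ->
  same_space (Lam w) (Gam v) -> w_infty w = 0%R.
Proof.
move=> wv [LG GL]; have [wi0 wi_le _] := w_infty_spec _ ww dw.
have td := tail_nonneg_decreasing _ wv.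
have GE f : measurable_fun setT f -> Gam v f = Lambda (tail v) f.
  by move=> _; exact: Gamma1_normE.
have [C C0 CW] := embeds_integral_le _ _ _ (tail v) (fun _ _ => erefl) GE LG.
have [D D0 DW] := embeds_integral_le _ _ (tail v) _ GE (fun _ _ => erefl) GL.
have tv_lty (T : R) : (0 < T)%R -> \int[mu]_(t in `](0%R:R), T[) tail v t < +oo.
  move=> T0; apply: (le_lt_trans (CW _ T0)).
  by rewrite lte_mul_pinfty ?lee_fin ?(ltW C0)//; exact: integral_weight_lty.
have tv1 : tail v 1%R < +oo.
  have := mule_le_integral _ _ td (@ltr01 R); rewrite mul1e => /le_lt_trans; apply.
  exact: tv_lty.
apply/eqP; rewrite eq_le wi0 andbT leNgt; apply/negP => wi.
(* The threshold [w_infty w / D] is what the reverse inclusion, with constant [D], forbids. *)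
have [b b0 tvb] := tail_small _ _ wv ltr01 tv1 _ (divr_gt0 wi D0).
have : (w_infty w)%:E <= D%:E * tail v b.
  apply: le_value_of_le_mean b0 => //; first exact: ltW.
  move=> T T0; apply: le_trans (DW _ T0); apply: le_trans (mule_le_integral _ _ wd T0).
  by rewrite -EFinM lee_fin mulrC ler_pM2l// wi_le.
apply/negP; rewrite -ltNge; apply: (@lt_le_trans _ _ (D%:E * (w_infty w / D)%:E)).
  by rewrite lte_pmul2l// lte_fin.
by rewrite -EFinM lee_fin mulrC divfK// gt_eqF.
Qed.

End decreasing_weight.

(** * Subtracting the limit at infinity from the weight *)

Section shifted_weight.
Variable w : R -> R.
Hypotheses (ww : weight w) (dw : decreasing w).

Let w_infty_w := w_infty_spec _ ww dw.
Let c := w_infty w.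
Let c0 : (0 <= c)%R. Proof. by have [] := w_infty_w. Qed.
Let u (t : R) : R := (w t - c)%R.

Let wu : weight u.
Proof.
have [mw w0 iw] := ww; have [_ cw _] := w_infty_w.
have mu_ : measurable_fun `](0%R:R), +oo[ u by exact: measurable_funB.
split => // [t t0|T T0]; first by rewrite subr_ge0 cw.
apply: le_integrable (iw _ T0) => //.
  apply/measurable_EFinP; apply: measurable_funS mu_ => //; exact: itv0_sub.
move=> t /=; rewrite in_itv/= => /andP[t0 _].
by rewrite lee_fin !ger0_norm ?subr_ge0 ?cw ?w0// gerBl.
Qed.

Let du : decreasing u.
Proof. by move=> s t s0 st; rewrite lerB// dw. Qed.

Let u_infty : w_infty u = 0%R.
Proof.
have [ui0 ui_le _] := w_infty_spec _ wu du; have [_ _ near_c] := w_infty_w.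
apply/eqP; rewrite eq_le ui0 andbT leNgt; apply/negP => ui.
by have [a a0] := near_c _ ui; have := ui_le _ a0; rewrite /u -/c; lra.
Qed.

Let Lambda_u f : measurable_fun setT f -> Lam w f = Lam u f + c%:E * L1 f.
Proof.
move=> mf; have ud := weight_nonneg_decreasing _ wu du.
rewrite L1_normE// -LambdaZ//.
rewrite [Lam u f]/(Lambda (EFin \o u) f) -LambdaD//; last first.
  by apply: nonneg_decreasingZ => //; exact: nonneg_decreasing_cst.
by apply: eq_integral => t _; rewrite mule1 /u -EFinD subrK.
Qed.

(** As [u = w - c] vanishes at infinity, its Lambda space is some Gamma space. If L^1 embedded in
    it, [u] and hence [w] would be bounded; if it embedded in L^1, the limit of [u] would be
    positive. *)
Lemma same_space_cap : (0 < w_infty w)%R -> ~ Linfty w ->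
  exists v : R -> R, [/\ weight v,
    same_space (Lam w) (@Gamma1_cap_L1_norm R n v),
    ~ embeds L1 (Gam v) & ~ embeds (Gam v) L1].
Proof.
rewrite -/c => cpos nLw; pose v := dyadic_difference u.
have wv : weight v := weight_dyadic_difference _ wu du.
have [uv vu] := same_space_dyadic_difference _ wu du u_infty.
have Lu0 f : 0 <= Lam u f by apply: Lambda_ge0; exact: weight_nonneg_decreasing.
exists v; split => //.
- have [[C [C0 CW]] [D [D0 DW]]] := (uv, vu); split.
    (* [C] controls the Gamma part, and [c^-1] recovers the L^1 norm from the summand [c * L1 f] of
       [Lambda_u]. *)
    exists (C + c^-1)%R; split => [|f mf]; first by rewrite addr_gt0 ?invr_gt0.
    rewrite /Gamma1_cap_L1_norm EFinD ge0_muleDl ?lee_fin ?invr_ge0 ?(ltW C0)//.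
    have c1 : c^-1%:E * (c%:E * L1 f) = L1 f by rewrite muleA -EFinM mulVf ?mul1e ?gt_eqF.
    apply: leeD.
      apply: (le_trans (CW _ mf)); rewrite lee_wpmul2l ?lee_fin ?(ltW C0)// Lambda_u//.
      by rewrite leeDl// mule_ge0 ?L1_norm_ge0.
    rewrite -{1}c1 lee_wpmul2l ?lee_fin ?invr_ge0// Lambda_u//.
    by rewrite leeDr.
  exists (D + c)%R; split => [|f mf]; first exact: addr_gt0.
  rewrite Lambda_u// /Gamma1_cap_L1_norm [leRHS]ge0_muleDr ?Gamma1_norm_ge0 ?L1_norm_ge0//.
  apply: leeD.
    apply: (le_trans (DW _ mf)); rewrite lee_wpmul2r ?Gamma1_norm_ge0//.
    by rewrite lee_fin lerDl.
  by rewrite lee_wpmul2r ?L1_norm_ge0// lee_fin lerDr ltW.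
- move=> /embeds_trans/(_ vu)/(embeds_L1_Lambda1_Linfty _ wu du).
  move=> /(Linfty_le _ wu du)[M uM]; apply: nLw; apply/(Linfty_le _ ww dw).
  by exists (M + c)%R => t t0; rewrite -lerBlDr; exact: uM.
- move=> /(embeds_trans _ _ _ uv)/(embeds_Lambda1_L1 _ wu du).
  by rewrite u_infty ltxx.
Qed.

End shifted_weight.

End embeddings.

Theorem theorem3p1 (R : realType) (n : nat) (w : R -> R) :
  (0 < n)%N -> weight w -> decreasing w ->
  [/\ (exists v : R -> R, weight v /\
         same_space (Lambda1_norm w) (@Gamma1_norm R n v)) <-> w_infty w = 0,
      same_space (Lambda1_norm w) (@L1_norm R n) <-> (0 < w_infty w /\ Linfty w)
    & (exists v : R -> R, [/\ weight v,
         same_space (Lambda1_norm w) (@Gamma1_cap_L1_norm R n v),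
         ~ embeds (@L1_norm R n) (Gamma1_norm v)
         & ~ embeds (Gamma1_norm v) (@L1_norm R n)])
      <-> (0 < w_infty w /\ ~ Linfty w)].
Proof.
move=> _ ww dw; split; split.
- by move=> [v [wv same_v]]; exact: same_space_Gamma1_w_infty same_v.
- move=> wi0; exists (dyadic_difference w); split; first exact: weight_dyadic_difference.
  exact: same_space_dyadic_difference.
- move=> [LL1 L1L]; split; first exact/(embeds_Lambda1_L1 _ ww dw)/LL1.
  exact: embeds_L1_Lambda1_Linfty L1L.
- move=> [wi Lw]; split; first exact/embeds_Lambda1_L1.
  exact: embeds_L1_Lambda1.
- move=> [v [wv [Lcap capL] L1G _]]; split.
    by apply/(embeds_Lambda1_L1 _ ww dw)/(embeds_trans _ _ _ Lcap); exact: embeds_cap_L1.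
  (* For bounded [w], L^1 would embed in Lambda, hence in the intersection and so in Gamma. *)
  move=> Lw; apply: L1G; apply: embeds_trans (embeds_cap_Gamma1 v).
  by apply: embeds_trans Lcap; exact: embeds_L1_Lambda1.
- by move=> [wi nLw]; exact: same_space_cap.
Qed.
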